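(* The graph $G$ (defined in the context) is a fastened $\{K_4,K_{2,2,2}\}$-ultrahomogeneous $\{K_4\}_{42}^4\{K_{2,2,2}\}_{21}^3$-graph which is not line-graphical, and its automorphism group $\mathcal A(G)$ satisfies $|\mathcal A(G)|=1008=4|E(G)|$. Moreover, $\mathcal A(G)$ acts transitively on the edges of $G$ with edge stabilizer $\Gamma$ of order 4 (so the edges of $G$ correspond to the left cosets of $\Gamma$ in $\mathcal A(G)$), and acts transitively on the vertices with vertex stabilizer of order 24 (so the vertices correspond to the left cosets of a subgroup of order 24).
   Context: The Fano plane $\mathcal F$ has points $1,\dots,7$ and lines $\{1,2,3\},\{1,4,5\},\{1,6,7\},\{2,4,6\},\{2,5,7\},\{3,4,7\},\{3,5,6\}$. For a point $p$, the three lines through $p$ are $\{p,q,r\}$ for three disjoint pairs $\{q,r\}$ partitioning $\mathcal F\setminus\{p\}$. An ordered pencil through $p$ is a tuple $v=(p,q_ar_a,q_br_b,q_cr_c)$ in which $q_ar_a,q_br_b,q_cr_c$ are these three (unordered) pairs listed in a chosen linear order. The graph $G$ has the 42 ordered pencils as vertices, with $v=(p,q_ar_a,q_br_b,q_cr_c)$ and $v'=(p',q'_ar'_a,q'_br'_b,q'_cr'_c)$ adjacent iff $p\neq p'$ and $|\{q_i,r_i\}\cap\{q'_i,r'_i\}|=1$ for each $i\in\{a,b,c\}$. A copy of $H$ in $G$ is an induced subgraph isomorphic to $H$. For a connected regular graph $H$ and integers $1<m<n$, an $\{H\}_n^m$-graph is a connected graph that (a) is an edge-disjoint union of $n$ induced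 copies of $H$; (b) has exactly $m$ copies of $H$ containing each vertex, no two of which share more than one vertex; (c) has exactly $n$ induced subgraphs isomorphic to $H$. An $\{H_1\}_{n_1}^{m_1}\{H_2\}_{n_2}^{m_2}$-graph ($H_1\ne H_2$) is one that is both an $\{H_1\}_{n_1}^{m_1}$-graph and an $\{H_2\}_{n_2}^{m_2}$-graph. It is $\{H_1,H_2\}$-ultrahomogeneous if for each $i=1,2$ every isomorphism between two copies of $H_i$ in it extends to an automorphism of the whole graph. It is fastened if each edge lies in exactly one copy of $H_1$ and exactly one copy of $H_2$. It is line-graphical if $\min(m_1,m_2)=m_1=2$ and $H_1$ is a complete graph. *)

(* Defs.v *)
From HB Require Import structures.
From mathcomp Require Import all_boot all_fingroup.

Set Implicit Arguments.
Unset Strict Implicit.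
Unset Printing Implicit Defensive.

Local Open Scope group_scope.

Record sgraph := SGraph {
  svertex :> finType;
  adj : rel svertex;
  adj_sym : symmetric adj;
  adj_irr : irreflexive adj }.

Arguments adj {s}.

Definition edges (G : sgraph) : {set {set G}} :=
  [set [set e.1; e.2] | e : G * G & adj e.1 e.2].

Definition connected_graph (G : sgraph) : Prop :=
  (0 < #|G|)%N /\ forall x y : G, connect adj x y.

Definition regular_graph (G : sgraph) : Prop :=
  exists k : nat, forall x : G, #|[set y | adj x y]| = k.

Definition complete_graph (G : sgraph) : Prop :=
  forall x y : G, x != y -> adj x y.

Definition isomorphic (H K : sgraph) : Prop :=
  exists f : H -> K, bijective f /\ forall x y, adj (f x) (f y) = adj x y.

Lemma complete_sym n : symmetric (fun x y : 'I_n => x != y).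
Proof. by move=> x y; rewrite eq_sym. Qed.

Lemma complete_irr n : irreflexive (fun x y : 'I_n => x != y).
Proof. by move=> x; rewrite eqxx. Qed.

Definition Kcomplete (n : nat) : sgraph :=
  SGraph (@complete_sym n) (@complete_irr n).

Definition multipartite_adj (r t : nat) : rel ('I_r * 'I_t) :=
  fun x y => x.1 != y.1.

Lemma multipartite_sym r t : symmetric (@multipartite_adj r t).
Proof. by move=> x y; rewrite /multipartite_adj eq_sym. Qed.

Lemma multipartite_irr r t : irreflexive (@multipartite_adj r t).
Proof. by move=> x; rewrite /multipartite_adj eqxx. Qed.

(* The complete r-partite graph whose r parts all have size t. *)
Definition Kmultipartite (r t : nat) : sgraph :=
  SGraph (@multipartite_sym r t) (@multipartite_irr r t).

Definition K4 : sgraph := Kcomplete 4.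
Definition K222 : sgraph := Kmultipartite 3 2.

(* An induced subgraph is represented by its vertex set A; its edges are the  *)
(* edges of G contained in A.                                                 *)
Definition edges_in (G : sgraph) (A : {set G}) : {set {set G}} :=
  [set e in edges G | e \subset A].

Definition copies (H G : sgraph) : {set {set G}} :=
  [set A : {set G} | [exists f : {ffun H -> G},
     [&& injectiveb f, f @: [set: H] == A
       & [forall x, forall y, adj (f x) (f y) == adj x y]]]].

Definition edge_disjoint_union (H G : sgraph) (n : nat) : Prop :=
  exists S : {set {set G}},
    [/\ #|S| = n,
        S \subset copies H G,
        {in S &, forall A B, A != B -> [disjoint edges_in A & edges_in B]},
        \bigcup_(A in S) A = [set: G]
      & \bigcup_(A in S) edges_in A = edges G].

Definition Hgraph (H : sgraph) (n m : nat) (G : sgraph) : Prop :=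
  [/\ connected_graph H /\ regular_graph H,
      (1 < m < n)%N,
      connected_graph G
    & [/\ edge_disjoint_union H G n,
          forall x : G,
            #|[set A in copies H G | x \in A]| = m /\
            {in [set A in copies H G | x \in A] &,
               forall A B, A != B -> (#|A :&: B| <= 1)%N}
        & #|copies H G| = n]].

Definition HHgraph (H1 : sgraph) (n1 m1 : nat) (H2 : sgraph) (n2 m2 : nat)
    (G : sgraph) : Prop :=
  [/\ ~ isomorphic H1 H2, Hgraph H1 n1 m1 G & Hgraph H2 n2 m2 G].

Definition graph_aut (G : sgraph) : {set {perm G}} :=
  [set s : {perm G} | [forall x, forall y, adj (s x) (s y) == adj x y]].

Lemma graph_aut_group_set G : group_set (graph_aut G).
Proof.
apply/group_setP; split=> [|s t].
  by rewrite inE; apply/'forall_forallP=> x y; rewrite !perm1.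
rewrite !inE => /'forall_forallP sP /'forall_forallP tP.
apply/'forall_forallP=> x y.
by rewrite !permM (eqP (tP _ _)) (eqP (sP _ _)).
Qed.

Canonical graph_aut_group G := Group (graph_aut_group_set G).

(* An isomorphism between the induced subgraphs on A and B is given by a map  *)
(* on all of G, of which only the values on A matter.                         *)
Definition copy_iso (G : sgraph) (A B : {set G}) (f : G -> G) : Prop :=
  [/\ {in A &, injective f}, f @: A = B
    & {in A &, forall x y, adj (f x) (f y) = adj x y}].

Definition iso_extend (H G : sgraph) : Prop :=
  forall (A B : {set G}) (f : G -> G),
    A \in copies H G -> B \in copies H G -> copy_iso A B f ->
    exists2 s : {perm G}, s \in graph_aut G & {in A, s =1 f}.

Definition ultrahomogeneous (H1 H2 G : sgraph) : Prop :=
  iso_extend H1 G /\ iso_extend H2 G.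

Definition fastened (H1 H2 G : sgraph) : Prop :=
  {in edges G, forall e : {set G},
     #|[set A in copies H1 G | e \subset A]| = 1%N /\
     #|[set A in copies H2 G | e \subset A]| = 1%N}.

Definition line_graphical (H1 : sgraph) (n1 m1 : nat)
    (H2 : sgraph) (n2 m2 : nat) (G : sgraph) : Prop :=
  [/\ HHgraph H1 n1 m1 H2 n2 m2 G,
      minn m1 m2 = m1, m1 = 2 & complete_graph H1].

(* The points of X correspond to the cosets in A of the stabilizer S of x, s x*)
(* corresponding to the coset of s. The product of permutations applies its   *)
(* left factor first, so the left coset {s o g | g in S} for composition of   *)
(* functions is the set S :* s.                                               *)
Definition coset_correspondence (aT : finGroupType) (T : finType)
    (to : {action aT &-> T}) (A : {set aT}) (X : {set T}) (x : T) : Prop :=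
  exists phi : T -> {set aT},
    [/\ {in X &, injective phi},
        phi @: X = rcosets 'C_A[x | to] A
      & {in A, forall s, phi (to x s) = 'C_A[x | to] :* s}].

Definition point : finType := 'I_7.

(* The point labelled k, for 1 <= k <= 7. *)
Definition pt (k : nat) : point := inord k.-1.

Definition fano_lines : {set {set point}} :=
  [set [set pt 1; pt 2; pt 3]; [set pt 1; pt 4; pt 5]; [set pt 1; pt 6; pt 7];
       [set pt 2; pt 4; pt 6]; [set pt 2; pt 5; pt 7]; [set pt 3; pt 4; pt 7];
       [set pt 3; pt 5; pt 6]].

Definition pairs_through (p : point) : {set {set point}} :=
  [set q : {set point} | (p \notin q) && (p |: q \in fano_lines)].

Definition is_ordered_pencil (v : point * {ffun 'I_3 -> {set point}}) : bool :=
  injectiveb v.2 && (v.2 @: [set: 'I_3] == pairs_through v.1).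

Definition pencil : finType :=
  {v : point * {ffun 'I_3 -> {set point}} | is_ordered_pencil v}.

Definition pencil_adj : rel pencil := fun v w =>
  ((val v).1 != (val w).1) &&
  [forall i, #|(val v).2 i :&: (val w).2 i| == 1%N].

Lemma pencil_adj_sym : symmetric pencil_adj.
Proof.
move=> v w; rewrite /pencil_adj eq_sym; congr (_ && _).
by apply: eq_forallb => i; rewrite setIC.
Qed.

Lemma pencil_adj_irr : irreflexive pencil_adj.
Proof. by move=> v; rewrite /pencil_adj eqxx. Qed.

Definition pencil_graph : sgraph := SGraph pencil_adj_sym pencil_adj_irr.

(* Main.v *)
Require Import Defs.
From mathcomp Require Import all_boot all_fingroup.

Set Implicit Arguments.
Unset Strict Implicit.
Unset Printing Implicit Defensive.

(** Label the points of the Fano plane by the nonzero vectors of F_2^3, so that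
    its lines are the kernels of the nonzero covectors.  The three lines through
    a point have covectors a, b, a + b, hence ordered pencils correspond to the
    42 frames (a, b) of distinct nonzero covectors, and two frames are adjacent
    iff their planes differ and one of the three entries a, b, a + b agrees.
    The group GL(3,2) x S_3, of order 1008, acts on frames: GL(3,2) linearly and
    S_3 by permuting the three entries.  The copies of K_{2,2,2} are the sets of
    frames with one prescribed entry, and those of K_4 are the sets
    {(a, b), (a + w, b), (a, b + w), (a + w, b + w)} with a, b, w independent.
    The group is simply transitive on labelled copies of K_4 and on labelled
    copies of K_{2,2,2}, which gives ultrahomogeneity.  It is the full
    automorphism group because an automorphism fixing a K_4 pointwise is
    trivial: adjacencies and numbers of common neighbours with already fixed
    vertices single out, in two rounds, every other vertex.  The facts about
    the 42 frames themselves are finite and are checked by computation. *)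

(** * Frames of F_2^3 *)

Definition vec := (bool * bool * bool)%type.

Definition vadd (u v : vec) : vec :=
  let: (a, b, c) := u in let: (a', b', c') := v in
  (a (+) a', b (+) b', c (+) c').

Definition vec0 : vec := (false, false, false).

Definition vscale (k : bool) (u : vec) : vec := if k then u else vec0.

Definition dot (u v : vec) : bool :=
  let: (a, b, c) := u in let: (a', b', c') := v in
  a && a' (+) b && b' (+) c && c'.

Definition e1 : vec := (true, false, false).
Definition e2 : vec := (false, true, false).
Definition e3 : vec := (false, false, true).

(** In this order the k-th vector is the binary expansion of k, with [e1] as lowest bit; the
    prescribed Fano lines then become the triples with sum zero. *)
Definition nzvecs : seq vec :=
  [:: e1; e2; vadd e1 e2; e3; vadd e1 e3; vadd e2 e3; vadd e1 (vadd e2 e3)].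

Definition frame := (vec * vec)%type.

Definition frame0 : frame := (e1, e2).

Definition third (x : frame) : vec := vadd x.1 x.2.

Definition frames : seq frame :=
  [seq x <- [seq (a, b) | a <- nzvecs, b <- nzvecs] | x.1 != x.2].

Arguments nzvecs : simpl never.
Arguments frames : simpl never.

Definition in_span (u : vec) (x : frame) : bool :=
  [|| u == x.1, u == x.2 | u == third x].

(* Nested [if]s, because [vm_compute] evaluates both arguments of [&&]. *)
Definition veq (u v : vec) : bool :=
  let: (a, b, c) := u in let: (a', b', c') := v in
  if a (+) a' then false else if b (+) b' then false else ~~ (c (+) c').

Definition feq (x y : frame) : bool :=
  if veq x.1 y.1 then veq x.2 y.2 else false.

(* Once an entry agrees, one more comparison tells whether the planes differ. *)
Definition fadj (x y : frame) : bool :=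
  if veq x.1 y.1 then
    if veq x.2 y.2 then false else ~~ veq (third x) y.2
  else if veq x.2 y.2 then ~~ veq (third x) y.1
  else if veq (third x) (third y) then ~~ veq x.2 y.1
  else false.

(** Equality is tested only for non-adjacent pairs: adjacent frames are distinct anyway. *)
Fixpoint fits (x : frame) (row : seq bool) (l : seq frame) : bool :=
  match row, l with
  | b :: row', y :: l' =>
    if fadj x y then if b then fits x row' l' else false
    else if b then false else if feq x y then false else fits x row' l'
  | _, _ => true
  end.

(** Each list gives the images of [hs], in order, under one induced embedding. Embeddings of the
    tail are extended by one vertex, so bad partial maps are pruned early. *)
Fixpoint embeddings (H : sgraph) (hs : seq H) : seq (seq frame) :=
  if hs is h :: hs' then
    let row := map (adj h) hs' in
    [seq x :: l | l <- embeddings hs', x <- [seq x <- frames | fits x row l]]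
  else [:: [::]].

(* On lists of equal length this keeps one list for each set of entries. *)
Fixpoint reps (s : seq (seq frame)) : seq (seq frame) :=
  if s is l :: s' then
    let r := reps s' in if has (fun m => all (mem m) l) r then r else l :: r
  else [::].

(** The linear map taking [e1], [e2], [e3] to [x.1], [x.2], [t]. *)
Definition lin (x : frame) (t u : vec) : vec :=
  let: (a, b, c) := u in vadd (vscale a x.1) (vadd (vscale b x.2) (vscale c t)).

(* [slot k] runs over the permutations of the three entries [a], [b], [a + b] *)
(* of a frame; [slot (slot_inv k)] is the inverse of [slot k].                *)
Definition slot (k : nat) (x : frame) : frame :=
  match k with
  | 0 => x
  | 1 => (x.2, x.1)
  | 2 => (x.1, third x)
  | 3 => (third x, x.2)
  | 4 => (x.2, third x)
  | _ => (third x, x.1)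
  end.

Definition slot_inv (k : nat) : nat := nth 0 [:: 0; 1; 2; 3; 5; 4] k.

Definition frame_map (k : nat) (x : frame) (t : vec) (y : frame) : frame :=
  slot k (lin x t y.1, lin x t y.2).

(** Once the image of [frame0] is prescribed, 6 slot permutations and the 4 vectors outside its
    plane leave 24 = 1008 / 42 maps. *)
Definition map_params : seq (nat * vec) := [seq (k, t) | k <- iota 0 6, t <- nzvecs].

(* The maps tried send [(e1, e2)] to the first entry of [l]. *)
Definition base_transitive (H : sgraph) (hs : seq H) (base : seq frame) :=
  all (fun l => has (fun p => let x := slot (slot_inv p.1) (head frame0 l) in
                  if in_span p.2 x then false
                  else map (frame_map p.1 x p.2) base == l) map_params)
    (embeddings hs).

Local Notation ord n k := (@Ordinal n k isT).

Definition K1_vertices : seq (Kcomplete 1) := [:: ord 1 0].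
Definition K2_vertices : seq (Kcomplete 2) := [:: ord 2 0; ord 2 1].
Definition K4_vertices : seq K4 := [:: ord 4 0; ord 4 1; ord 4 2; ord 4 3].
Definition K222_vertices : seq K222 :=
  [seq (i, j) | j <- [:: ord 2 0; ord 2 1], i <- [:: ord 3 0; ord 3 1; ord 3 2]].

(** The K_4 with a = [e1], b = [e2], w = [e3]. Its first entry and its first two entries also serve
    as base vertex and base arc. *)
Definition K4_base : seq frame :=
  [:: (e1, e2); (vadd e1 e3, e2); (e1, vadd e2 e3); (vadd e1 e3, vadd e2 e3)].
(** The frames with first entry [e1]. Second entries three places apart have sum [e1], so they give
    the same plane; these are the non-adjacent pairs, matching the order of [K222_vertices]. *)
Definition K222_base : seq frame :=
  [:: (e1, e2); (e1, e3); (e1, vadd e2 e3);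
      (e1, vadd e1 e2); (e1, vadd e1 e3); (e1, vadd e1 (vadd e2 e3))].


Definition codegree (x y : frame) : nat :=
  count (fun z => if fadj x z then fadj y z else false) frames.

(** One round of colour refinement: keeps the frames that their adjacencies and codegrees with [l]
    tell apart from all others. *)
Definition refine (l : seq frame) : seq frame :=
  let profiles := [seq (y, [seq (fadj y z, codegree y z) | z <- l]) | y <- frames] in
  [seq p.1 | p <- profiles & count (fun q => q.2 == p.2) profiles == 1].

Definition grow (l : seq frame) : seq frame :=
  [seq y <- frames | (y \in l) || has (fadj y) l].

Definition copies_check (R : seq (seq frame)) (n m : nat) : bool :=
  [&& size R == n,
      all (fun x => count (fun l => x \in l) R == m) frames,
      all (fun e => count (fun l => all (mem l) e) R == 1)
        (embeddings K2_vertices)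
    & all (fun l : seq frame =>
         all (fun l' => (l == l') || (count (mem l) l' <= 1)) R) R].

(** * Finite checks on the 42 frames *)

Lemma K1_trans : base_transitive K1_vertices (take 1 K4_base).
Proof. by vm_compute. Qed.

Lemma K2_trans : base_transitive K2_vertices (take 2 K4_base).
Proof. by vm_compute. Qed.

Lemma K4_trans : base_transitive K4_vertices K4_base.
Proof. by vm_compute. Qed.

Lemma K222_trans : base_transitive K222_vertices K222_base.
Proof. by vm_compute. Qed.

Lemma K4_check : copies_check (reps (embeddings K4_vertices)) 42 4.
Proof. by vm_compute. Qed.

Lemma K222_check : copies_check (reps (embeddings K222_vertices)) 21 3.
Proof. by vm_compute. Qed.

Lemma size_K2_reps : size (reps (embeddings K2_vertices)) == 252.
Proof. by vm_compute. Qed.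

Lemma size_K4_embeddings : size (embeddings K4_vertices) == 1008.
Proof. by vm_compute. Qed.

Lemma refine_K4_base : all (mem (iter 2 refine K4_base)) frames.
Proof. by vm_compute. Qed.

Lemma grow_frame0 : all (mem (iter 3 grow [:: frame0])) frames.
Proof. by vm_compute. Qed.

Lemma lin_check :
  all (fun x => all (fun t => if in_span t x then true else
    all (fun u => all (fun v =>
       veq (lin x t (vadd u v)) (vadd (lin x t u) (lin x t v)) &&
       (veq (lin x t u) (lin x t v) == veq u v))
      (vec0 :: nzvecs)) (vec0 :: nzvecs)) nzvecs) frames.
Proof. by vm_compute. Qed.

Lemma slot_check :
  all (fun k => all (fun x => (slot k x \in frames) &&
    all (fun y => (fadj (slot k x) (slot k y) == fadj x y) &&
         (feq (slot k x) (slot k y) == feq x y)) frames) frames) (iota 0 6).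
Proof. by vm_compute. Qed.

Lemma fadj_sym_check : all (fun x => all (fun y => fadj x y == fadj y x) frames) frames.
Proof. by vm_compute. Qed.

Lemma veqE (u v : vec) : veq u v = (u == v).
Proof. by move: u v => [[[] []] []] [[[] []] []]. Qed.

Lemma feqE (x y : frame) : feq x y = (x == y).
Proof.
case: x y => [a b] [a' b']; rewrite /feq !veqE /= xpair_eqE.
by case: (a == a').
Qed.

Lemma mem_vecs (u : vec) : u \in vec0 :: nzvecs.
Proof. by move: u => [[[] []] []]. Qed.

Lemma mem_nzvecs (u : vec) : (u \in nzvecs) = (u != vec0).
Proof. by move: u => [[[] []] []]. Qed.

Lemma mem_frames (x : frame) :
  (x \in frames) = [&& x.1 != vec0, x.2 != vec0 & x.1 != x.2].
Proof. by move: x => [[[[] []] []] [[[] []] []]]. Qed.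

(** * Ordered pencils as frames *)

Definition bits (z : point) : vec := nth vec0 nzvecs z.

Lemma bitsN z : bits z \in nzvecs.
Proof. by apply: mem_nth; apply: (ltn_ord z). Qed.

Lemma bits_inj : injective bits.
Proof.
move=> z z' /eqP; rewrite nth_uniq // ?(ltn_ord z) ?(ltn_ord z') // => /eqP.
exact: val_inj.
Qed.

Lemma bits_surj u : u \in nzvecs -> exists z, bits z = u.
Proof.
move=> uN; have iP : index u nzvecs < 7 by rewrite -index_mem in uN.
by exists (Ordinal iP); rewrite /bits nth_index.
Qed.

Lemma card_bits (Q : pred vec) : #|[set z | Q (bits z)]| = count Q nzvecs.
Proof.
rewrite cardE size_filter -enumT (eq_count (a2 := Q \o bits)) => [|z]; last first.
  by rewrite /= inE.
rewrite -count_map; congr count.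
apply: (@eq_from_nth _ vec0); first by rewrite size_map size_enum_ord.
move=> i; rewrite size_map size_enum_ord => i7.
by rewrite (nth_map (Ordinal i7)) ?size_enum_ord // /bits nth_enum_ord.
Qed.

Definition line (l : vec) : {set point} := [set z | ~~ dot l (bits z)].

(** A covector is determined by its values on the basis vectors, which are themselves points. *)
Lemma line_inj : injective line.
Proof.
move=> l m E; have dotE u : u \in nzvecs -> dot l u = dot m u.
  by case/bits_surj=> z <-; move/setP/(_ z): E; rewrite !inE => /negb_inj.
have := dotE e1 isT; have := dotE e2 isT; have := dotE e3 isT.
by move: l m {E dotE} => [[[] []] []] [[[] []] []].
Qed.

(** Reduces an equality of point sets to one of seven-entry boolean lists, settled by computation;
    [z.+1] is the label of the point with index [z]. *)
Lemma fano_lineE i j k l :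
    [/\ 0 < i < 8, 0 < j < 8 & 0 < k < 8] ->
    [seq ~~ dot l u | u <- nzvecs] = [seq z.+1 \in [:: i; j; k] | z <- iota 0 7] ->
  [set pt i; pt j; pt k] = line l.
Proof.
move=> [iP jP kP] E; apply/setP=> z; rewrite !inE.
have ptE m : 0 < m < 8 -> (z == pt m) = (z.+1 == m).
  by case: m => // m mP; rewrite -val_eqE /= inordK.
have := congr1 (fun s => nth false s z) E.
rewrite (nth_map vec0) ?(ltn_ord z) // (nth_map 0) ?size_iota ?(ltn_ord z) //.
by rewrite nth_iota ?(ltn_ord z) // add0n /bits => ->; rewrite !inE !ptE // orbA.
Qed.

Lemma fano_linesP (A : {set point}) :
  reflect (exists2 l, l \in nzvecs & A = line l) (A \in fano_lines).
Proof.
(* These are the covectors of the seven lines, in the order of [fano_lines]. *)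
have -> : A \in fano_lines = (A \in map line [:: e3; e2; vadd e2 e3; e1; vadd e1 e3;
                               vadd e1 e2; vadd e1 (vadd e2 e3)]).
  rewrite /fano_lines (@fano_lineE 1 2 3 e3) // (@fano_lineE 1 4 5 e2) //.
  rewrite (@fano_lineE 1 6 7 (vadd e2 e3)) // (@fano_lineE 2 4 6 e1) //.
  rewrite (@fano_lineE 2 5 7 (vadd e1 e3)) // (@fano_lineE 3 4 7 (vadd e1 e2)) //.
  by rewrite (@fano_lineE 3 5 6 (vadd e1 (vadd e2 e3))) // !inE -!orbA.
apply: (iffP mapP) => -[l lN ->]; exists l => //; move: lN; rewrite !inE.
  by do !case/orP; move=> /eqP->.
by do !case/orP; move=> /eqP->.
Qed.

Lemma pairs_throughP p (q : {set point}) :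
  reflect (exists l, [/\ l \in nzvecs, ~~ dot l (bits p) & q = line l :\ p])
          (q \in pairs_through p).
Proof.
rewrite inE; apply: (iffP andP) => [[pq pqF]|[l [lN lp ->]]].
  have [l lN lE] := elimT (fano_linesP _) pqF.
  exists l; split=> //; last by rewrite -lE setU1K.
  by have := setU11 p q; rewrite lE inE.
rewrite in_setD1 eqxx; split=> //; apply: (introT (fano_linesP _)); exists l => //.
by rewrite setD1K // inE.
Qed.

Lemma line_pair_inj p l m : ~~ dot l (bits p) -> ~~ dot m (bits p) ->
  line l :\ p = line m :\ p -> l = m.
Proof.
move=> lp mp E; apply: line_inj.
by rewrite -(setD1K (a := p) (A := line l)) ?inE // E setD1K ?inE.
Qed.

(** The cross product over F_2: for a frame, the only nonzero vector killed by both covectors, hence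
    the point of the pencil. *)
Definition cross (x : frame) : vec :=
  let: ((a, b, c), (a', b', c')) := x in
  (b && c' (+) c && b', c && a' (+) a && c', a && b' (+) b && a').

Definition entry (x : frame) (i : nat) : vec := nth vec0 [:: x.1; x.2; third x] i.

Definition pole (x : frame) : point := inord (index (cross x) nzvecs).

Definition pencil_of (x : frame) : point * {ffun 'I_3 -> {set point}} :=
  (pole x, [ffun i : 'I_3 => line (entry x i) :\ pole x]).

Lemma cross_check : all (fun x => (cross x \in nzvecs) &&
    all (fun l => (~~ dot l (cross x) == in_span l x) &&
          ((~~ dot x.1 l && ~~ dot x.2 l) == (l == cross x))) nzvecs) frames.
Proof. by vm_compute. Qed.

(** Distinct poles lie on one joining line, whose covector is the only nonzero one common to both
    planes. Two different lines in slot i meet in one point, which is a pole exactly when one of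
    them is the joining line; two equal lines are the joining line and share one further point. So
    all three pairs meet in one point iff the joining line has the same slot in both frames. *)
Lemma adj_check : all (fun x => all (fun y => fadj x y ==
    (if veq (cross x) (cross y) then false else
     all (fun i => count (fun z =>
       if veq z (cross x) then false else if veq z (cross y) then false else
       if dot (entry x i) z then false else ~~ dot (entry y i) z) nzvecs == 1) (iota 0 3)))
     frames) frames.
Proof. by vm_compute. Qed.

Lemma bits_pole x : x \in frames -> bits (pole x) = cross x.
Proof.
move=> xF; have /allP/(_ _ xF)/andP[cN _] := cross_check.
by rewrite /bits /pole inordK ?nth_index // -[7]/(size nzvecs) index_mem.
Qed.

Lemma cross_dot x l : x \in frames -> l \in nzvecs -> ~~ dot l (cross x) = in_span l x.
Proof.
by move=> xF lN; have /allP/(_ _ xF)/andP[_ /allP/(_ _ lN)/andP[/eqP]] := cross_check.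
Qed.

Lemma cross_uniq x l : x \in frames -> l \in nzvecs ->
  ~~ dot x.1 l -> ~~ dot x.2 l -> l = cross x.
Proof.
move=> xF lN l1 l2; have /allP/(_ _ xF)/andP[_ /allP/(_ _ lN)/andP[_]] := cross_check.
by rewrite l1 l2 => /eqP/esym/eqP.
Qed.

Lemma entryP x (i : 'I_3) : x \in frames ->
  entry x i \in nzvecs /\ ~~ dot (entry x i) (cross x).
Proof.
move=> xF; have eN : entry x i \in nzvecs.
  case: x xF => [[[[] []] []] [[[] []] []]] //; by case: i => -[|[|[|//]]].
split=> //; rewrite cross_dot //; rewrite /in_span.
by case: i {eN} => -[|[|[|//]]] iP; rewrite /entry /= eqxx ?orbT.
Qed.

Lemma entry_inj x (i j : 'I_3) : x \in frames -> entry x i = entry x j -> i = j.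
Proof.
move=> xF /eqP; rewrite nth_uniq ?(ltn_ord i) ?(ltn_ord j) //; first by move/eqP/val_inj.
by case: x xF => [[[[] []] []] [[[] []] []]].
Qed.

Lemma pencil_ofP x : x \in frames -> is_ordered_pencil (pencil_of x).
Proof.
move=> xF; have pE := bits_pole xF; apply/andP; split=> /=.
  apply/injectiveP=> i j; rewrite !ffunE => E; apply: (@entry_inj x i j xF).
  apply: (line_pair_inj (p := pole x)); rewrite ?pE //.
    by case: (entryP i xF).
  by case: (entryP j xF).
apply/eqP/setP=> q; apply/imsetP/pairs_throughP => [[i _ ->]|[l [lN lp ->]]].
  by rewrite ffunE; exists (entry x i); rewrite pE; case: (entryP i xF).
rewrite pE cross_dot // in lp.
have [i ->] : exists i : 'I_3, l = entry x i.
  by case/or3P: lp => /eqP->; [exists (ord 3 0)|exists (ord 3 1)|exists (ord 3 2)].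
by exists i; [rewrite in_setT | rewrite ffunE].
Qed.

Lemma pencil_of_surj v : is_ordered_pencil v -> exists2 x, x \in frames & pencil_of x = v.
Proof.
case: v => p f /andP[/= /injectiveP fI /eqP/setP fE].
have fP i : exists l, [/\ l \in nzvecs, ~~ dot l (bits p) & f i = line l :\ p].
  by apply/pairs_throughP; rewrite -fE imset_f.
have [l0 [N0 p0 f0]] := fP (ord 3 0).
have [l1 [N1 p1 f1]] := fP (ord 3 1).
have [l2 [N2 p2 f2]] := fP (ord 3 2).
have xF : (l0, l1) \in frames.
  rewrite mem_frames -!mem_nzvecs N0 N1 /=; apply/eqP => E.
  by have /fI : f (ord 3 0) = f (ord 3 1) by rewrite f0 f1 E.
have pE : bits p = cross (l0, l1) by apply: cross_uniq => //; apply: bitsN.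
have poleE : pole (l0, l1) = p by apply: bits_inj; rewrite bits_pole.
(* The third line through [p] has its covector in the span of [l0] and [l1], and injectivity of [f]
   excludes these two. *)
have E2 : l2 = third (l0, l1).
  move: p2; rewrite pE cross_dot // => /or3P[] /eqP E //.
    by have /fI : f (ord 3 2) = f (ord 3 0) by rewrite f0 f2 E.
  by have /fI : f (ord 3 2) = f (ord 3 1) by rewrite f1 f2 E.
exists (l0, l1) => //; rewrite /pencil_of poleE; congr pair.
apply/ffunP=> -[[|[|[|//]]] iP]; rewrite ffunE /entry /=.
- by rewrite -f0; congr (f _); apply: val_inj.
- by rewrite -f1; congr (f _); apply: val_inj.
by rewrite -E2 -f2; congr (f _); apply: val_inj.
Qed.

Lemma pencil_of_inj : {in frames &, injective pencil_of}.
Proof.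
move=> x y xF yF [pE] /ffunP fE.
have eE (i : 'I_3) : entry x i = entry y i.
  have := fE i; rewrite !ffunE pE => E; apply: (line_pair_inj (p := pole y)) => //.
    by rewrite -pE bits_pole //; case: (entryP i xF).
  by rewrite bits_pole //; case: (entryP i yF).
by case: x y {xF yF pE fE} eE => [a b] [c d] eE; congr pair;
  [apply: (eE (ord 3 0)) | apply: (eE (ord 3 1))].
Qed.

Definition pencil0 : pencil :=
  Sub (pencil_of frame0) (pencil_ofP (isT : frame0 \in frames)).

(** The default [pencil0] is never taken on [frames]. *)
Definition frame_pencil (x : frame) : pencil_graph := insubd pencil0 (pencil_of x).

Lemma val_frame_pencil x : x \in frames -> val (frame_pencil x) = pencil_of x.
Proof. by move=> xF; rewrite /frame_pencil val_insubd pencil_ofP. Qed.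

Lemma frame_pencil_inj : {in frames &, injective frame_pencil}.
Proof.
by move=> x y xF yF /(congr1 val); rewrite !val_frame_pencil //; apply: pencil_of_inj.
Qed.

Lemma frame_pencil_surj v : exists2 x, x \in frames & frame_pencil x = v.
Proof.
have [x xF xE] := pencil_of_surj (valP v); exists x => //.
by apply: val_inj; rewrite val_frame_pencil.
Qed.

Lemma frame_pencil_adj :
  {in frames &, forall x y, adj (frame_pencil x) (frame_pencil y) = fadj x y}.
Proof.
move=> x y xF yF; rewrite /adj /= /pencil_adj !val_frame_pencil //= -(inj_eq bits_inj).
rewrite !bits_pole //; have /allP/(_ _ xF)/allP/(_ _ yF)/eqP-> := adj_check; rewrite veqE.
set a := all _ _; case: eqP => //= _; rewrite {}/a.
have countE (i : 'I_3) : #|(pencil_of x).2 i :&: (pencil_of y).2 i| =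
    count (fun z =>
       if veq z (cross x) then false else if veq z (cross y) then false else
       if dot (entry x i) z then false else ~~ dot (entry y i) z) nzvecs.
  rewrite -card_bits !ffunE; apply: eq_card => z.
  rewrite !inE -!(inj_eq bits_inj) !bits_pole // !veqE.
  case: (_ == cross x); case: (_ == cross y) => //=.
    by rewrite andbF.
  by case: (dot (entry x i) _).
apply/forallP/allP => [P i|P i]; last by rewrite countE P // mem_iota (ltn_ord i).
by rewrite mem_iota => i3; have := P (Ordinal i3); rewrite countE.
Qed.

(** * Graphs isomorphic to the graph of frames *)

(* Keeps [//] from trying to decide membership in [frames] by unfolding. *)
Opaque frames.

Lemma fadj_irr x : fadj x x = false.
Proof. by rewrite /fadj !veqE !eqxx. Qed.

Lemma fadj_sym : {in frames &, forall x y, fadj x y = fadj y x}.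
Proof. by move=> x y xF yF; have /allP/(_ _ xF)/allP/(_ _ yF)/eqP := fadj_sym_check. Qed.

Definition frame_aut (f : frame -> frame) : Prop :=
  [/\ {in frames, forall x, f x \in frames}, {in frames &, injective f}
    & {in frames &, forall x y, fadj (f x) (f y) = fadj x y}].

(** [fadj] only compares entries and their sums, which an injective additive map respects; the slot
    permutations are covered by [slot_check]. *)
Lemma frame_map_aut k x t : k < 6 -> x \in frames -> t \in nzvecs ->
  ~~ in_span t x -> frame_aut (frame_map k x t).
Proof.
move=> k6 xF tN txN; have kI : k \in iota 0 6 by rewrite mem_iota.
have linP u v : lin x t (vadd u v) = vadd (lin x t u) (lin x t v) /\
                (lin x t u == lin x t v) = (u == v).
  have /allP/(_ _ xF)/allP/(_ _ tN) := lin_check.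
  rewrite (negPf txN) => /allP/(_ _ (mem_vecs u))/allP/(_ _ (mem_vecs v)).
  by rewrite !veqE => /andP[/eqP ? /eqP].
have lin0 : lin x t vec0 = vec0 by case: (x) (t) => [[[? ?] ?] [[? ?] ?]] [[? ?] ?].
have lin_eq u v := (linP u v).2.
have linF y : y \in frames -> (lin x t y.1, lin x t y.2) \in frames.
  (* Writing [vec0] as its own image turns nonvanishing into a case of injectivity. *)
  by rewrite !mem_frames /= -{3 4}lin0 !lin_eq.
have slotP y z : y \in frames -> z \in frames -> [/\ slot k y \in frames,
    fadj (slot k y) (slot k z) = fadj y z & (slot k y == slot k z) = (y == z)].
  move=> yF zF; have /allP/(_ _ kI)/allP/(_ _ yF)/andP[-> /allP/(_ _ zF)] := slot_check.
  by rewrite !feqE => /andP[/eqP ? /eqP ?].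
split=> [y yF|y z yF zF|y z yF zF]; first by case: (slotP _ _ (linF _ yF) (linF _ yF)).
  case: (slotP _ _ (linF _ yF) (linF _ zF)) => _ _ E /eqP; rewrite E.
  case: y z {yF zF E} => [a b] [c d]; rewrite !xpair_eqE /= !lin_eq.
  by case/andP=> /eqP-> /eqP->.
case: (slotP _ _ (linF _ yF) (linF _ zF)) => _ -> _.
have third_lin w : third (lin x t w.1, lin x t w.2) = lin x t (third w).
  by rewrite /third /= (linP _ _).1.
by rewrite /fadj !third_lin !veqE !lin_eq.
Qed.

Lemma frame_aut_base (H : sgraph) (hs : seq H) base l :
    base_transitive hs base -> l \in embeddings hs -> head frame0 l \in frames ->
  exists2 f, frame_aut f & map f base = l.
Proof.
move=> /allP/[apply] /hasP[[k t] /allpairsP[[k' t'] [kI tN ktE]]].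
move: ktE kI tN => [<- <-]; rewrite mem_iota [(_, _).1]/= [(_, _).2]/= => k6 tN.
cbv zeta; case: ifPn => // txN /eqP E lF.
exists (frame_map k (slot (slot_inv k) (head frame0 l)) t) => //.
apply: frame_map_aut => //.
have iI : slot_inv k \in iota 0 6 by move: k k6 {E txN}; do 6?[case=> //].
by have /allP/(_ _ iI)/allP/(_ _ lF)/andP[] := slot_check.
Qed.

(** * Correctness of the enumeration of embeddings *)

Lemma fitsP (H : sgraph) (h : H) (hs : seq H) (f : H -> frame) x :
  reflect {in hs, forall k, fadj x (f k) = adj h k /\ x <> f k}
          (fits x (map (adj h) hs) (map f hs)).
Proof.
elim: hs => [|k hs IH] /=; first by constructor.
have cons_iff : (fadj x (f k) = adj h k /\ x <> f k) ->
    ({in hs, forall k, fadj x (f k) = adj h k /\ x <> f k} <->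
     {in k :: hs, forall k, fadj x (f k) = adj h k /\ x <> f k}).
  move=> kP; split=> P k'; last by move=> k'hs; apply: P; rewrite inE k'hs orbT.
  by rewrite inE => /predU1P[->|/P].
have nP (b : bool) : b = false -> ~ (fadj x (f k) = adj h k /\ x <> f k) ->
    reflect {in k :: hs, forall k, fadj x (f k) = adj h k /\ x <> f k} b.
  by move=> -> N; constructor=> P; apply: N; apply: P; rewrite mem_head.
rewrite feqE; case: ifP => [A|A]; case: ifP => [B|B].
- have /cons_iff[cons1 cons2] : fadj x (f k) = adj h k /\ x <> f k.
    by split=> [|E]; [rewrite B | rewrite E fadj_irr in A].
  exact: (iffP IH cons1 cons2).
- by apply: nP; rewrite // A B => -[].
- by apply: nP; rewrite // A B => -[].
case: eqP => [E|E]; first by apply: nP => // -[].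
have /cons_iff[cons1 cons2] : fadj x (f k) = adj h k /\ x <> f k by rewrite B.
exact: (iffP IH cons1 cons2).
Qed.

Definition frame_embedding (H : sgraph) (hs : seq H) (f : H -> frame) : Prop :=
  [/\ {in hs, forall h, f h \in frames}, {in hs &, injective f}
    & {in hs &, forall h k, fadj (f h) (f k) = adj h k}].

Lemma embeddings_complete (H : sgraph) (hs : seq H) f :
  uniq hs -> frame_embedding hs f -> map f hs \in embeddings hs.
Proof.
elim: hs => [|h hs IH] //= /andP[hN hU] [fF fI fA].
have sub k : k \in hs -> k \in h :: hs by move=> khs; rewrite inE khs orbT.
apply/allpairsPdep; exists (map f hs), (f h); split=> //.
  apply: IH => //; split=> [k /sub/fF //|k l /sub ks /sub ls|k l /sub ks /sub ls].
    exact: fI.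
  exact: fA.
rewrite mem_filter fF ?mem_head // andbT; apply/fitsP=> k khs.
split; first by rewrite fA ?mem_head ?sub.
by move/fI => E; rewrite (E (mem_head _ _) (sub _ khs)) khs in hN.
Qed.

Lemma embeddings_sound (H : sgraph) (hs : seq H) l :
  uniq hs -> l \in embeddings hs ->
  exists2 f : H -> frame, frame_embedding hs f & l = map f hs.
Proof.
elim: hs l => [|h hs IH] l /=; first by rewrite inE => _ /eqP->; exists (fun=> frame0).
move=> /andP[hN hU] /allpairsPdep[l' [x [/(IH _ hU)[f [fF fI fA] El']]]].
rewrite mem_filter El' => /andP[/fitsP xP xF ->].
pose g k := if k == h then x else f k.
have gh : g h = x by rewrite /g eqxx.
have gE k : k \in hs -> g k = f k.
  by rewrite /g; case: eqP => // -> hhs; rewrite hhs in hN.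
exists g; last by rewrite /= gh; congr (_ :: _); apply/eq_in_map => k /gE.
split=> [k|k k'|k k']; rewrite in_cons.
- by case/predU1P=> [->|khs]; rewrite ?gh // gE // fF.
- case/predU1P=> [->|khs]; rewrite in_cons => /predU1P[->|k'hs] //; rewrite ?gh ?gE //.
  + by case: (xP _ k'hs).
  + by move/esym; case: (xP _ khs).
  by apply: fI.
case/predU1P=> [->|khs]; rewrite in_cons => /predU1P[->|k'hs] //; rewrite ?gh ?gE //.
- by rewrite fadj_irr adj_irr.
- by case: (xP _ k'hs).
- by rewrite fadj_sym ?fF // adj_sym; case: (xP _ khs).
exact: fA.
Qed.

Lemma embeddings_uniq (H : sgraph) (hs : seq H) : uniq (embeddings hs).
Proof.
elim: hs => //= h hs IH; apply: allpairs_uniq_dep => //.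
  by move=> l _; apply: filter_uniq.
by move=> [l x] [l' x'] _ _ /= [-> ->].
Qed.

Lemma reps_sub s : {subset reps s <= s}.
Proof.
elim: s => //= l s IH m; case: ifP => _; first by move/IH; rewrite inE orbC => ->.
by rewrite !inE => /predU1P[->|/IH->]; rewrite ?eqxx ?orbT.
Qed.

Lemma reps_cover s l : l \in s -> exists2 m, m \in reps s & all (mem m) l.
Proof.
elim: s => //= l' s IH; rewrite inE => /predU1P[->|/IH[m mR lm]]; last first.
  by exists m => //; case: ifP; rewrite ?inE ?mR ?orbT.
case: ifP => [/hasP[m mR lm]|_]; first by exists m.
by exists l'; rewrite ?mem_head //; apply/allP.
Qed.

Section FrameModel.

Variables (G : sgraph) (dec : frame -> G).
Hypothesis dec_inj : {in frames &, injective dec}.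
Hypothesis dec_surj : forall v, exists2 x, x \in frames & dec x = v.
Hypothesis dec_adj : {in frames &, forall x y, adj (dec x) (dec y) = fadj x y}.

Definition code (v : G) : frame := nth frame0 frames (find (fun x => dec x == v) frames).

Lemma code_has v : has (fun x => dec x == v) frames.
Proof. by have [x xF <-] := dec_surj v; apply/hasP; exists x. Qed.

Lemma codeF v : code v \in frames.
Proof. by rewrite mem_nth // -has_find code_has. Qed.

Lemma codeK v : dec (code v) = v.
Proof. exact/eqP/(nth_find frame0 (code_has v)). Qed.

Lemma decK : {in frames, cancel dec code}.
Proof. by move=> x xF; apply: dec_inj; rewrite ?codeF ?codeK. Qed.

Lemma code_inj : injective code. Proof. exact: can_inj codeK. Qed.

Lemma code_adj v w : fadj (code v) (code w) = adj v w.
Proof. by rewrite -dec_adj ?codeF // !codeK. Qed.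

Definition vset (l : seq frame) : {set G} := [set v | code v \in l].

Lemma lift_aut f : frame_aut f ->
  exists2 s : {perm G}, s \in graph_aut G & forall v, s v = dec (f (code v)).
Proof.
case=> fF fI fA; have gI : injective (fun v => dec (f (code v))).
  move=> v w E; apply/code_inj/fI; rewrite ?codeF //.
  by apply: dec_inj; rewrite ?fF ?codeF.
exists (perm gI) => [|v]; last by rewrite permE.
rewrite inE; apply/'forall_forallP => v w.
by rewrite !permE dec_adj ?fF ?codeF // fA ?codeF // code_adj.
Qed.

Lemma graph_autP (s : {perm G}) v w : s \in graph_aut G -> adj (s v) (s w) = adj v w.
Proof. by rewrite inE => /'forall_forallP/(_ v w)/eqP. Qed.

Definition embeds (H : sgraph) (f : H -> G) : Prop :=
  injective f /\ forall h k, adj (f h) (f k) = adj h k.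

Lemma copiesP (H : sgraph) (A : {set G}) :
  reflect (exists2 f : H -> G, embeds f & f @: [set: H] = A) (A \in copies H G).
Proof.
rewrite inE; apply: (iffP existsP).
  move=> [f /and3P[/injectiveP fI /eqP fA /'forall_forallP fH]].
  by exists f => //; split=> // h k; apply/eqP.
case=> f [fI fH] <-; exists (finfun f); apply/and3P; split.
- by apply/injectiveP => h k; rewrite !ffunE => /fI.
- by apply/eqP/eq_imset => h; rewrite ffunE.
by apply/'forall_forallP => h k; rewrite !ffunE fH.
Qed.

(** * Copies of H and extension of isomorphisms between them *)

Section Copies.

Variables (H : sgraph) (hs : seq H).
Hypothesis hsU : uniq hs.
Hypothesis hsT : forall h, h \in hs.

Lemma embeds_mem f : embeds f -> map (code \o f) hs \in embeddings hs.
Proof.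
case=> fI fH; apply: embeddings_complete => //; split=> [h _|h k _ _|h k _ _] /=.
- exact: codeF.
- by move/code_inj/fI.
by rewrite code_adj.
Qed.

Lemma mem_embeds l : l \in embeddings hs ->
  exists2 f : H -> G, embeds f & l = map (code \o f) hs.
Proof.
move=> /(embeddings_sound hsU)[f [fF fI fA] ->]; exists (dec \o f).
  split=> [h k E|h k] /=; last by rewrite dec_adj ?fF // fA.
  by apply: fI => //; apply: dec_inj; rewrite ?fF.
by apply/eq_in_map => h _ /=; rewrite decK ?fF.
Qed.

Lemma vset_embeds f : vset (map (code \o f) hs) = f @: [set: H].
Proof.
apply/setP=> v; rewrite inE.
by apply/mapP/imsetP => [[h _ /code_inj->]|[h _ ->]]; exists h.
Qed.

Lemma embeddings_list l : l \in embeddings hs ->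
  [/\ uniq l, size l = size hs & {subset l <= frames}].
Proof.
move=> /mem_embeds[f [fI _] ->]; rewrite size_map map_inj_uniq //; last first.
  exact: inj_comp code_inj fI.
by split=> // x /mapP[h _ ->]; apply: codeF.
Qed.

(** Of two lists with the same entries [reps] drops the earlier, and [vset] determines the entries
    of a list of frames. *)
Lemma vset_uniq : uniq (map vset (reps (embeddings hs))).
Proof.
have sF l : l \in embeddings hs -> {subset l <= frames} by case/embeddings_list.
elim: (embeddings hs) sF => //= l s IH sF.
have {}IH : uniq (map vset (reps s)).
  by apply: IH => m ms; apply: sF; rewrite inE ms orbT.
case: ifPn => //= /hasPn lN; rewrite IH andbT; apply/mapP => -[m /lN /allP mN E].
apply: mN => x xl; have xF := sF _ (mem_head _ _) _ xl.
by move/setP/(_ (dec x)): E; rewrite !inE decK // xl => <-.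
Qed.

Lemma mem_copies (A : {set G}) :
  (A \in copies H G) = (A \in map vset (reps (embeddings hs))).
Proof.
apply/copiesP/mapP => [[f fE <-]|[l /reps_sub /mem_embeds[f fE ->] ->]]; last first.
  by exists f; rewrite ?vset_embeds.
have fL := embeds_mem fE; have [m mR /allP lm] := reps_cover fL.
exists m => //; rewrite -vset_embeds; apply/setP=> v; rewrite !inE.
have [lU lS _] := embeddings_list fL; have [_ mS _] := embeddings_list (reps_sub mR).
(* [reps] only provides an inclusion of entries; equal lengths and the absence of repetitions make
   it an equality. *)
by have [_ ->] := uniq_min_size lU lm (eq_leq (etrans mS (esym lS))).
Qed.

Lemma card_copies (Q : pred {set G}) :
  #|[set A in copies H G | Q A]| = count (Q \o vset) (reps (embeddings hs)).
Proof.
rewrite -count_map -size_filter -(card_uniqP _) ?filter_uniq ?vset_uniq //.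
by apply: eq_card => A; rewrite inE mem_filter mem_copies andbC.
Qed.

Lemma embeds_transitive base f :
    base_transitive hs base -> {subset base <= frames} -> embeds f ->
  exists2 s : {perm G}, s \in graph_aut G & map (s \o dec) base = map f hs.
Proof.
move=> bT bF fE; have fL := embeds_mem fE.
have [|g gA gE] := frame_aut_base bT fL.
  have [_ _] := embeddings_list fL; case: (map _ hs) => //= x l; apply.
  by rewrite mem_head.
have [s sA sE] := lift_aut gA; exists s => //.
transitivity (map dec (map g base)).
  by rewrite -map_comp; apply/eq_in_map => x xb /=; rewrite sE decK ?bF.
by rewrite gE -map_comp; apply: eq_map => h /=; rewrite codeK.
Qed.

(** The labelled copies [g] and [f \o g] are images of the base copy under automorphisms [s] and
    [t], so [s^-1 * t] carries the first to the second and agrees with [f] on [A]. *)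
Lemma iso_extend_model base :
  base_transitive hs base -> {subset base <= frames} -> iso_extend H G.
Proof.
move=> bT bF A B f /copiesP[g gE <-] _ [fI _ fA].
have gA h : g h \in g @: [set: H] by rewrite imset_f.
have fgE : embeds (f \o g).
  have [gI gH] := gE; split=> [h k E|h k /=]; last by rewrite fA.
  by apply: gI; apply: fI.
have [s sA sE] := embeds_transitive bT bF gE.
have [t tA tE] := embeds_transitive bT bF fgE.
exists (s^-1 * t)%g; first by rewrite groupM ?groupV.
have /eq_in_map E : map ((s^-1 * t)%g \o g) hs = map (f \o g) hs.
  rewrite map_comp -sE -tE -map_comp; apply: eq_map => x /=.
  by rewrite permM permK.
by move=> _ /imsetP[h _ ->]; apply: E.
Qed.

End Copies.

(** * Rigidity and the order of the automorphism group *)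

Lemma perm_frames : perm_eq (enum G) (map dec frames).
Proof.
apply/uniq_perm; rewrite ?enum_uniq ?map_inj_in_uniq //.
by move=> v; rewrite mem_enum inE -[v]codeK map_f ?codeF.
Qed.

Lemma count_frames (Q : pred frame) : count Q frames = #|[set v | Q (code v)]|.
Proof.
rewrite cardE size_filter (eq_count (a2 := Q \o code)) => [|v]; last by rewrite /= inE.
rewrite -enumT (seq.permP perm_frames) count_map; apply: eq_in_count => x xF /=.
by rewrite decK.
Qed.

Lemma codegree_aut (s : {perm G}) v w : s \in graph_aut G ->
  codegree (code (s v)) (code (s w)) = codegree (code v) (code w).
Proof.
move=> sA; have codegreeE v' w' :
    codegree (code v') (code w') = #|[set u | adj v' u && adj w' u]|.
  apply: etrans (count_frames _) _; apply: eq_card => u.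
  by rewrite !in_set !code_adj; case: (adj v' u).
rewrite !codegreeE -(card_imset (mem [set u | adj v u && adj w u]) (@perm_inj _ s)).
apply: eq_card => u; rewrite -[u](permKV s) mem_imset; last exact: perm_inj.
by rewrite !in_set !graph_autP.
Qed.

(** Since [s] fixes the vertices of [l] and preserves adjacency and codegree, a vertex and its image
    have the same profile; a profile held by one vertex only forces them to coincide. *)
Lemma refine_fixed (s : {perm G}) l : s \in graph_aut G ->
  {in l, forall x, x \in frames /\ s (dec x) = dec x} ->
  {in refine l, forall x, x \in frames /\ s (dec x) = dec x}.
Proof.
move=> sA lF _ /mapP[[y p] + ->]; rewrite mem_filter => /andP[/eqP yp yP].
have /mapP[y' yF [? ?]] := yP; subst y' p; split=> //=.
pose prof y := (y, [seq (fadj y z, codegree y z) | z <- l]).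
have zP : prof (code (s (dec y))) \in map prof frames by rewrite map_f ?codeF.
have zE : (prof (code (s (dec y)))).2 = (prof y).2.
  apply/eq_in_map => x /lF[xF xE].
  rewrite -{1 2}(decK xF) -{1 2}xE codegree_aut // code_adj graph_autP //.
  by rewrite -code_adj !decK.
move: yp; rewrite -size_filter.
set r := filter _ _ => r1.
have yr : prof y \in r by rewrite mem_filter /= eqxx yP.
have zr : prof (code (s (dec y))) \in r by rewrite mem_filter zE eqxx zP.
case: r r1 yr zr => [|q []] // _; rewrite !inE => /eqP<- /eqP[E _].
by rewrite -[LHS]codeK E.
Qed.

Lemma K4_baseF : {subset K4_base <= frames}.
Proof. by apply/allP. Qed.

Lemma aut_rigid (s : {perm G}) : s \in graph_aut G ->
  {in K4_base, forall x, s (dec x) = dec x} -> s = 1%g.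
Proof.
move=> sA sB.
have iF n : {in iter n refine K4_base, forall x,
    x \in frames /\ s (dec x) = dec x}.
  elim: n => [x xB|n IH]; first by rewrite K4_baseF ?sB.
  exact: refine_fixed.
apply/permP => v; rewrite perm1 -[v]codeK.
by have /allP/(_ _ (codeF v))/iF[] := refine_K4_base.
Qed.

Lemma K4_vertices_full : uniq K4_vertices /\ forall h, h \in K4_vertices.
Proof. by split=> // -[[|[|[|[|]]]] hP]. Qed.

Lemma embeds_aut (H : sgraph) (f : H -> G) (s : {perm G}) :
  s \in graph_aut G -> embeds f -> embeds (s \o f).
Proof.
move=> sA [fI fH]; split=> [h k /= /perm_inj /fI //|h k /=].
by rewrite graph_autP.
Qed.

(** Sending an automorphism to the image of the labelled [K4_base] is a bijection onto the labelled
    K_4's: injective by rigidity, surjective by [K4_trans]. *)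
Lemma card_graph_aut : #|graph_aut G| = 1008.
Proof.
have [hsU hsT] := K4_vertices_full.
rewrite -(eqP size_K4_embeddings) cardE.
pose F (s : {perm G}) := map (fun x => code (s (dec x))) K4_base.
rewrite -(size_map F); apply/perm_size/uniq_perm.
- rewrite map_inj_in_uniq ?enum_uniq // => s t; rewrite !mem_enum => sA tA /eq_in_map E.
  apply/eqP; rewrite eq_mulgV1; apply/eqP/aut_rigid; first by rewrite groupM ?groupV.
  by move=> x /E/code_inj Ex; rewrite permM Ex permK.
- exact: embeddings_uniq.
move=> l; apply/mapP/idP => [[s] | lE].
  rewrite mem_enum => sA ->.
  have /(mem_embeds hsU hsT)[f fE bE] : K4_base \in embeddings K4_vertices by vm_compute.
  rewrite /F bE -map_comp (eq_map (g := code \o (s \o f))) => [|h]; last first.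
    by rewrite /= codeK.
  exact/embeds_mem/embeds_aut.
have [f fE ->] := mem_embeds hsU hsT lE.
have [s sA sE] := embeds_transitive hsU hsT K4_trans K4_baseF fE.
by exists s; rewrite ?mem_enum // map_comp -sE -map_comp.
Qed.

Lemma card_model : #|G| = 42.
Proof. by rewrite cardE (perm_size perm_frames) size_map. Qed.

(** Three breadth-first rounds from [frame0] reach every frame. *)
Lemma connected_model : connected_graph G.
Proof.
split=> [|v w]; first by rewrite card_model.
have cF n : {in iter n grow [:: frame0], forall x,
    x \in frames /\ connect adj (dec frame0) (dec x)}.
  elim: n => [x|n IH x] /=; first by rewrite inE => /eqP->.
  rewrite mem_filter => /andP[/orP[/IH //|/hasP[y /IH[yF yC] xy]] xF]; split=> //.
  by apply: connect_trans yC _; apply: connect1; rewrite dec_adj // fadj_sym.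
have c0 u : connect adj (dec frame0) u.
  by have /allP/(_ _ (codeF u))/cF[_] := grow_frame0; rewrite codeK.
by apply: connect_trans (c0 w); rewrite (sym_connect_sym (@adj_sym G)).
Qed.

(** * Edges as copies of K_2 *)

Lemma K2_vertices_full : uniq K2_vertices /\ forall h, h \in K2_vertices.
Proof. by split=> // -[[|[|]] hP]. Qed.

Lemma edgesP (e : {set G}) :
  reflect (exists v w, adj v w /\ e = [set v; w]) (e \in edges G).
Proof.
apply: (iffP imsetP) => [[[v w]]|[v [w [vw ->]]]].
  by rewrite inE => vw ->; exists v, w.
by exists (v, w) => //; rewrite inE.
Qed.

Definition pair_fun (v w : G) (h : Kcomplete 2) : G := if h == 0 :> nat then v else w.

Lemma pair_fun_embeds v w : adj v w -> embeds (pair_fun v w).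
Proof.
move=> vw; have vNw : v <> w by move=> E; rewrite E adj_irr in vw.
have wv : adj w v by rewrite adj_sym.
split=> -[[|[|//]] hP] [[|[|//]] kP]; rewrite /pair_fun /= ?adj_irr //.
- by move=> _; apply: val_inj.
- by move=> E; case: vNw.
- by move=> _; apply: val_inj.
Qed.

(** Lets the enumeration of copies count the edges as well. *)
Lemma edges_copies : edges G = copies (Kcomplete 2) G.
Proof.
apply/setP=> e; apply/edgesP/copiesP => [[v [w [vw ->]]]|[f [fI fH] <-]].
  exists (pair_fun v w); first exact: pair_fun_embeds.
  apply/setP=> u; rewrite !inE.
  apply/imsetP/orP => [[[[|[|//]] hP] _ ->]|[]/eqP->]; first by left.
  - by right.
  - by exists (ord 2 0).
  - by exists (ord 2 1).
exists (f (ord 2 0)), (f (ord 2 1)); split; first by rewrite fH.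
apply/setP=> u; rewrite !inE; apply/imsetP/orP => [[h _ ->]|[]/eqP->]; try by eexists.
by case: h => -[|[|//]] hP; [left|right]; apply/eqP; congr f; apply: val_inj.
Qed.

Lemma card_edges_model : #|edges G| = 252.
Proof.
have [hsU hsT] := K2_vertices_full.
rewrite edges_copies -(eqP size_K2_reps).
have := card_copies hsU hsT predT; rewrite count_predT => <-.
by apply: eq_card => A; rewrite [RHS]in_set andbT.
Qed.

(** * Copy counts and the edge-disjoint decomposition *)

Section CopyCounts.

Variables (H : sgraph) (hs : seq H) (n m : nat).
Hypothesis hsU : uniq hs.
Hypothesis hsT : forall h, h \in hs.
Hypothesis hs_check : copies_check (reps (embeddings hs)) n m.

Lemma edge_in_one_copy e : e \in edges G ->
  #|[set A in copies H G | e \subset A]| = 1.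
Proof.
move=> /edgesP[v [w [vw ->]]]; have [hU hT] := K2_vertices_full.
rewrite (card_copies hsU hsT); case/and4P: hs_check => _ _ /allP + _.
move/(_ _ (embeds_mem hU (pair_fun_embeds vw)))/eqP => E.
rewrite -[RHS]E; apply: eq_count => l.
rewrite /comp subUset !sub1set !in_set /=.
by case: (code v \in l) => //=; case: (code w \in l).
Qed.

Lemma card_copies_at v : #|[set A in copies H G | v \in A]| = m.
Proof.
rewrite (card_copies hsU hsT); case/and4P: hs_check => _ /allP/(_ _ (codeF v))/eqP + _ _.
by move=> <-; apply: eq_count => l; rewrite /= inE.
Qed.

Lemma card_all_copies : #|copies H G| = n.
Proof.
case/and4P: hs_check => /eqP<- _ _ _.
have := card_copies hsU hsT predT; rewrite count_predT => <-.
by apply: eq_card => A; rewrite [RHS]in_set andbT.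
Qed.

Lemma card_copies_meet : {in copies H G &, forall A B, A != B -> #|A :&: B| <= 1}.
Proof.
move=> A B; rewrite !(mem_copies hsU hsT) => /mapP[l lR ->] /mapP[l' l'R ->] lNl'.
case/and4P: hs_check => _ _ _ /allP/(_ _ lR)/allP/(_ _ l'R).
case: eqP => [E|_ /= le1]; first by rewrite E eqxx in lNl'.
apply: leq_trans le1; rewrite -size_filter -(size_map dec).
apply: leq_trans (card_size _).
apply/subset_leq_card/subsetP => v; rewrite in_setI !in_set => /andP[vl vl'].
by apply/mapP; exists (code v); rewrite ?codeK // mem_filter vl' andbT.
Qed.

Lemma Hgraph_model : connected_graph H -> regular_graph H -> 1 < m < n -> Hgraph H n m G.
Proof.
move=> Hc Hr mn; split=> //; first exact: connected_model.
split=> [|v|]; last exact: card_all_copies; last first.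
  split=> [|A B]; first exact: card_copies_at.
  by move=> /setIdP[AC _] /setIdP[BC _]; apply: card_copies_meet.
(* The decomposition consists of all copies: two copies sharing an edge coincide, because each edge
   lies in exactly one. *)
exists (copies H G); split=> //; first exact: card_all_copies.
- move=> A B AC BC AB; rewrite -setI_eq0; apply: contraR AB => /set0Pn[e].
  move=> /setIP[/setIdP[eE eA] /setIdP[_ eB]].
  have /eqP/cards1P[C /setP E] := edge_in_one_copy eE.
  have memC D : D \in copies H G -> e \subset D -> D = C.
    by move=> DC eD; apply/set1P; rewrite -E; apply/setIdP.
  by rewrite (memC A) // (memC B).
- apply/setP=> v; rewrite in_setT; apply/bigcupP.
  have /card_gt0P[A /setIdP[AC vA]] : 0 < #|[set A in copies H G | v \in A]|.
    by rewrite card_copies_at; case/andP: mn => /ltnW.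
  by exists A.
apply/setP=> e; apply/bigcupP/idP => [[A _ /setIdP[]] //|eE].
have /card_gt0P[A /setIdP[AC eA]] : 0 < #|[set A in copies H G | e \subset A]|.
  by rewrite edge_in_one_copy.
by exists A => //; apply/setIdP.
Qed.

(* Transitivity on edges and vertices *)
End CopyCounts.

Lemma edges_transitive : [transitive graph_aut G, on edges G | 'P^*].
Proof.
have [hU hT] := K2_vertices_full.
have bF : {subset take 2 K4_base <= frames} by apply/allP.
pose e0 : {set G} := [set dec (nth frame0 K4_base 0); dec (nth frame0 K4_base 1)].
have actE (s : {perm G}) v w : ('P^*)%act [set v; w] s = [set s v; s w].
  by rewrite /= /setact imsetU1 imset_set1 /= /aperm.
apply/imsetP; exists e0.
  apply/edgesP; eexists; eexists; split; last by [].
  by rewrite dec_adj // bF.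
apply/setP=> e; apply/edgesP/orbitP => [[v [w [vw ->]]]|[s sA <-]].
  have [s sA [/= sv sw]] := embeds_transitive hU hT K2_trans bF (pair_fun_embeds vw).
  by exists s => //; rewrite actE sv sw.
rewrite actE; eexists; eexists; split; last by [].
by rewrite graph_autP // dec_adj // bF.
Qed.

Lemma vertices_transitive : [transitive graph_aut G, on [set: G] | 'P].
Proof.
have hU : uniq K1_vertices by [].
have hT h : h \in K1_vertices by case: h => -[|[]].
have bF : {subset take 1 K4_base <= frames} by apply/allP.
apply/imsetP; exists (dec frame0); rewrite ?inE //.
apply/setP=> v; rewrite inE; apply/esym/orbitP.
have [|s sA [sv]] := @embeds_transitive _ _ hU hT _ (fun=> v) K1_trans bF.
  by split=> -[[|//] hP] [[|//] kP]; rewrite ?adj_irr // => _; apply: val_inj.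
by exists s; rewrite //= apermE.
Qed.

End FrameModel.

(** * Orbits, stabilizers and cosets *)

Section TransitiveCosets.

Variables (aT : finGroupType) (T : finType) (to : {action aT &-> T}).
Variables (A : {group aT}) (X : {set T}).
Hypothesis trX : [transitive A, on X | to].

(** The correspondence sends y to the set of elements of [A] moving x to y, which is a coset of the
    stabilizer of x. *)
Lemma transitive_coset_correspondence x : x \in X -> coset_correspondence to A X x.
Proof.
move=> xX; have oX := atransP trX _ xX; exists (amove to A x); split.
- by rewrite -oX; apply: can_in_inj (amoveK (subsetT A)).
- by rewrite -oX amove_orbit ?subsetT.
by move=> s sA; rewrite amove_act ?subsetT.
Qed.

Lemma card_transitive_stab x k : x \in X -> 0 < #|X| ->
  #|A| = #|X| * k -> #|'C_A[x | to]%g| = k.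
Proof.
move=> xX X0 E; apply/eqP; rewrite -(eqn_pmul2l X0) -E -(card_orbit_stab to A x).
by rewrite (atransP trX _ xX).
Qed.

End TransitiveCosets.

(** * Complete and complete multipartite graphs *)

Lemma K222_vertices_full : uniq K222_vertices /\ forall h, h \in K222_vertices.
Proof. by split=> // -[[[|[|[|//]]] iP] [[|[|//]] jP]]. Qed.

Lemma complete_connected n : 0 < n -> connected_graph (Kcomplete n).
Proof.
move=> n0; split=> [|x y]; first by rewrite card_ord.
by have [->|xy] := eqVneq x y; [apply: connect0 | apply: connect1].
Qed.

Lemma complete_regular n : regular_graph (Kcomplete n).
Proof.
exists n.-1 => x; rewrite -[n in RHS]card_ord -(cardsC1 x).
by apply: eq_card => y; rewrite !inE eq_sym.
Qed.

Lemma multipartite_connected r t : 1 < r -> 0 < t -> connected_graph (Kmultipartite r t).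
Proof.
move=> r1 t0; have r0 : 0 < r by apply: ltnW.
split=> [|x y]; first by rewrite card_prod !card_ord muln_gt0 r0.
have [xy|xy] := eqVneq x.1 y.1; last exact: connect1.
(* Vertices of one part are joined through a vertex of another part: part 1 if theirs is part 0, and
   part 0 otherwise. *)
have [i ix] : exists i : 'I_r, i != x.1.
  case: (posnP x.1) => [x0|x0]; [exists (Ordinal r1) | exists (Ordinal r0)].
    by rewrite -val_eqE /= x0.
  by rewrite -val_eqE /= neq_ltn x0.
apply: (@connect_trans _ _ (i, Ordinal t0)); apply: connect1.
  by rewrite /= /multipartite_adj eq_sym.
by rewrite /= /multipartite_adj -xy.
Qed.

Lemma multipartite_regular r t : regular_graph (Kmultipartite r t).
Proof.
exists (r.-1 * t) => x.
have -> : [set y : Kmultipartite r t | adj x y] = setX [set~ x.1] [set: 'I_t].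
  by apply/setP=> -[i j]; rewrite !inE andbT eq_sym.
by rewrite cardsX cardsC1 cardsT !card_ord.
Qed.

(** * Application to the graph of ordered pencils *)

Local Open Scope group_scope.

Theorem theorem5p1 :
  [/\ HHgraph K4 42 4 K222 21 3 pencil_graph,
      ultrahomogeneous K4 K222 pencil_graph,
      fastened K4 K222 pencil_graph,
      ~ line_graphical K4 42 4 K222 21 3 pencil_graph
    & ~ line_graphical K222 21 3 K4 42 4 pencil_graph] /\
  (#|graph_aut pencil_graph| = 1008 /\
   1008 = 4 * #|edges pencil_graph|)%N /\
  [/\ [transitive graph_aut pencil_graph, on edges pencil_graph | 'P^*],
      {in edges pencil_graph, forall e,
         #|'C_(graph_aut pencil_graph)[e | 'P^*]| = 4}
    & {in edges pencil_graph, forall e,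
         coset_correspondence 'P^* (graph_aut pencil_graph)
           (edges pencil_graph) e}] /\
  [/\ [transitive graph_aut pencil_graph, on [set: pencil_graph] | 'P],
      forall v : pencil_graph, #|'C_(graph_aut pencil_graph)[v | 'P]| = 24
    & forall v : pencil_graph,
        coset_correspondence 'P (graph_aut pencil_graph) [set: pencil_graph] v].
Proof.
have inj := frame_pencil_inj; have surj := frame_pencil_surj.
have adjE := frame_pencil_adj.
have [U4 T4] := K4_vertices_full; have [U222 T222] := K222_vertices_full.
have cE : #|edges pencil_graph| = 252 := card_edges_model inj surj adjE.
have cA : #|graph_aut pencil_graph| = 1008 := card_graph_aut inj surj adjE.
have cG : #|[set: pencil_graph]| = 42 by rewrite cardsT (card_model inj surj).
have trE := edges_transitive inj surj adjE.
have trV := vertices_transitive inj surj adjE.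
pose A := graph_aut_group pencil_graph.
split; last split; last split.
- split.
  (* K_4 and K_{2,2,2} have 4 and 6 vertices. *)
  + split; first by case=> f [/bij_eq_card]; rewrite card_prod !card_ord.
    * apply: (Hgraph_model inj surj adjE U4 T4 K4_check) => //.
        exact: complete_connected.
      exact: complete_regular.
    apply: (Hgraph_model inj surj adjE U222 T222 K222_check) => //.
      exact: multipartite_connected.
    exact: multipartite_regular.
  + split; first exact: (iso_extend_model inj surj adjE U4 T4 K4_trans K4_baseF).
    apply: (iso_extend_model inj surj adjE U222 T222 K222_trans).
    by apply/allP; vm_compute.
  + move=> e eE; split.
      exact: (edge_in_one_copy inj surj adjE U4 T4 K4_check).
    exact: (edge_in_one_copy inj surj adjE U222 T222 K222_check).
  (* A line-graphical graph has two copies of the first kind at each vertex; here there are 4 or 3,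
     according to the order of the pair. *)
  + by case.
  by case.
- by rewrite cE.
- split=> // e eE.
    by apply: (card_transitive_stab (A := A) trE); rewrite ?cE.
  exact: (transitive_coset_correspondence (A := A) trE).
- split=> // v.
    by apply: (card_transitive_stab (A := A) trV); rewrite ?in_setT ?cG.
  by apply: (transitive_coset_correspondence (A := A) trV); rewrite in_setT.
Qed.
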